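(* Let $\mathcal{A}\in\mathbb{C}^{\mathbf{I}(N)\times\mathbf{I}(N)}$ with $\mathrm{ind}(\mathcal{A})=k$, and let $\mathcal{B}\in\mathbb{C}^{\mathbf{I}(N)}$ with $\mathcal{B}\in\mathfrak{R}(\mathcal{A}^k)$. Then the set of all solutions $\mathcal{X}\in\mathbb{C}^{\mathbf{I}(N)}$ of the equation $$\mathcal{A}^{k+1}*_N\mathcal{X}=\mathcal{A}^{k}*_N\mathcal{B}$$ is $\mathcal{A}^{D}*_N\mathcal{B}+\mathcal{N}(\mathcal{A}^{k})$. Moreover, $\mathcal{X}=\mathcal{A}^{D}*_N\mathcal{B}$ is the unique solution of this equation in $\mathfrak{R}(\mathcal{A}^k)$.
   Context: For positive integers $I_1,\dots,I_N$ write $\mathbf{I}(N)=I_1\times\cdots\times I_N$; $\mathbb{C}^{\mathbf{I}(N)\times\mathbf{J}(N)}$ is the set of complex tensors with entries $a_{i_1\dots i_N j_1\dots j_N}$, $1\le i_s\le I_s$, $1\le j_s\le J_s$. The Einstein product of $\mathcal{A}\in\mathbb{C}^{\mathbf{I}(N)\times\mathbf{K}(N)}$ and $\mathcal{B}\in\mathbb{C}^{\mathbf{K}(N)\times\mathbf{J}(N)}$ is $(\mathcal{A}*_N\mathcal{B})_{i_1\dots i_N j_1\dots j_N}=\sum_{k_1,\dots,k_N}a_{i_1\dots i_N k_1\dots k_N}b_{k_1\dots k_N j_1\dots j_N}$; for $\mathcal{X}\in\mathbb{C}^{\mathbf{K}(N)}$, $(\mathcal{A}*_N\mathcal{X})_{i_1\dots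 i_N}=\sum_{k_1,\dots,k_N}a_{i_1\dots i_N k_1\dots k_N}x_{k_1\dots k_N}$. Powers of $\mathcal{A}\in\mathbb{C}^{\mathbf{I}(N)\times\mathbf{I}(N)}$ are taken with $*_N$, and $\mathcal{A}^0$ is the identity tensor. The range and null space are $\mathfrak{R}(\mathcal{A})=\{\mathcal{A}*_N\mathcal{X}:\mathcal{X}\in\mathbb{C}^{\mathbf{I}(N)}\}$ and $\mathcal{N}(\mathcal{A})=\{\mathcal{X}\in\mathbb{C}^{\mathbf{I}(N)}:\mathcal{A}*_N\mathcal{X}=\mathcal{O}\}$. The index $\mathrm{ind}(\mathcal{A})$ is the smallest nonnegative integer $k$ with $\mathfrak{R}(\mathcal{A}^k)=\mathfrak{R}(\mathcal{A}^{k+1})$. The Drazin inverse $\mathcal{A}^D$ of $\mathcal{A}$ with $\mathrm{ind}(\mathcal{A})=k$ is the (unique, always existing) tensor $\mathcal{X}\in\mathbb{C}^{\mathbf{I}(N)\times\mathbf{I}(N)}$ with $\mathcal{A}^{k+1}*_N\mathcal{X}=\mathcal{A}^k$, $\mathcal{X}*_N\mathcal{A}*_N\mathcal{X}=\mathcal{X}$, $\mathcal{A}*_N\mathcal{X}=\mathcal{X}*_N\mathcal{A}$. *)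

(* Defs.v *)
From HB Require Import structures.
From mathcomp Require Import all_boot all_order all_algebra.
From mathcomp Require Import boolp classical_sets reals.
From mathcomp Require Import complex.
Set Implicit Arguments.
Unset Strict Implicit.
Unset Printing Implicit Defensive.
Import GRing.Theory.
Local Open Scope ring_scope.
Local Open Scope classical_set_scope.

Definition mindex (N : nat) (I : 'I_N -> nat) : finType :=
  {dffun forall s : 'I_N, 'I_(I s)}.

Definition tensor (R : realType) (N : nat) (I J : 'I_N -> nat) :=
  {ffun mindex I * mindex J -> R[i]}.

Definition tensorv (R : realType) (N : nat) (I : 'I_N -> nat) :=
  {ffun mindex I -> R[i]}.

Definition einstein (R : realType) (N : nat) (I K J : 'I_N -> nat)
    (A : tensor R I K) (B : tensor R K J) : tensor R I J :=
  [ffun p => \sum_(k : mindex K) A (p.1, k) * B (k, p.2)].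

Definition einsteinv (R : realType) (N : nat) (I K : 'I_N -> nat)
    (A : tensor R I K) (X : tensorv R K) : tensorv R I :=
  [ffun i => \sum_(k : mindex K) A (i, k) * X k].

Notation "A *N B" := (einstein A B) (at level 40, left associativity).
Notation "A *v X" := (einsteinv A X) (at level 40, left associativity).

Definition idt (R : realType) (N : nat) (I : 'I_N -> nat) : tensor R I I :=
  [ffun p => (p.1 == p.2)%:R].

Definition tpow (R : realType) (N : nat) (I : 'I_N -> nat)
    (A : tensor R I I) (n : nat) : tensor R I I :=
  iter n (einstein A) (idt R I).

Notation "A ^N n" := (tpow A n) (at level 30, right associativity).

Definition trange (R : realType) (N : nat) (I : 'I_N -> nat)
    (A : tensor R I I) : set (tensorv R I) :=
  [set A *v X | X in setT].

Definition tnull (R : realType) (N : nat) (I : 'I_N -> nat)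
    (A : tensor R I I) : set (tensorv R I) :=
  [set X | A *v X = 0].

Lemma einsteinvA (R : realType) (N : nat) (I K J : 'I_N -> nat)
    (A : tensor R I K) (B : tensor R K J) (X : tensorv R J) :
  (A *N B) *v X = A *v (B *v X).
Proof.
apply/ffunP => i; rewrite !ffunE.
under eq_bigr => j _ do rewrite ffunE mulr_suml.
rewrite exchange_big /=; apply: eq_bigr => k _; rewrite ffunE mulr_sumr.
by apply: eq_bigr => j _; rewrite mulrA.
Qed.

Lemma tpowv (R : realType) (N : nat) (I : 'I_N -> nat) (A : tensor R I I)
    (n : nat) (X : tensorv R I) : (A ^N n) *v X = iter n (einsteinv A) X.
Proof.
elim: n => [|n IHn]; last by rewrite /= einsteinvA IHn.
apply/ffunP => i; rewrite ffunE (bigD1 i) //= ffunE eqxx mul1r big1 ?addr0 //.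
by move=> k ki; rewrite ffunE eq_sym (negPf ki) mul0r.
Qed.

Lemma trange_stable (R : realType) (N : nat) (I : 'I_N -> nat)
    (A : tensor R I I) :
  exists k, `[< trange (A ^N k) = trange (A ^N k.+1) >].
Proof.
pose V := {ffun mindex I -> R[i]^o}.
pose f n (X : V) : V := (A ^N n) *v X.
have f_lin n : linear (f n).
  move=> a X Y; apply/ffunP => i; rewrite !ffunE scaler_sumr -big_split /=.
  by apply: eq_bigr => k _; rewrite !ffunE mulrDr scalerAr.
pose fL n := GRing.isLinear.Build _ _ _ _ (f n) (f_lin n).
pose g n : {linear V -> V} := HB.pack (f n) (fL n).
pose U n := limg (linfun (g n)).
have UP n (Y : V) : Y \in U n <-> trange (A ^N n) Y.
  split=> [/memv_imgP[X _ ->]|[X _ <-]]; first by exists X; rewrite // lfunE.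
  by apply/memv_imgP; exists X; rewrite ?memvf // lfunE.
have subU n : (U n.+1 <= U n)%VS.
  apply/subvP => Y /UP [X _ <-]; apply/UP.
  by exists (A *v X); rewrite // !tpowv iterSr.
apply: contrapT => noK.
have ltU n : (\dim (U n.+1) < \dim (U n))%N.
  rewrite ltnNge; apply/negP => leU; apply: noK; exists n; apply/asboolP.
  have /eqP eqU : U n.+1 == U n by rewrite -(geq_leqif (dimv_leqif_eq (subU n))).
  by apply/seteqP; split=> Y /UP YU; apply/UP; rewrite -?eqU // eqU.
have bnd n : (\dim (U n) + n <= \dim (U 0))%N.
  elim: n => [|n IHn]; first by rewrite addn0.
  by apply: leq_trans IHn; rewrite addnS -addSn leq_add2r.
by have := bnd (\dim (U 0)).+1; rewrite addnS ltnNge leq_addl.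
Qed.

Definition ind (R : realType) (N : nat) (I : 'I_N -> nat)
    (A : tensor R I I) : nat := ex_minn (trange_stable A).

Definition is_drazin (R : realType) (N : nat) (I : 'I_N -> nat)
    (A X : tensor R I I) : Prop :=
  [/\ A ^N (ind A).+1 *N X = A ^N (ind A),
      X *N A *N X = X &
      A *N X = X *N A].

(* The default value 0 is never reached: a tensor satisfying [is_drazin A]
   always exists, and it is unique. *)
Definition drazin (R : realType) (N : nat) (I : 'I_N -> nat)
    (A : tensor R I I) : tensor R I I := xget 0 (is_drazin A).

(* Main.v *)
(** A tensor acts as a square matrix, so its range stabilises at [k] exactly when
    [A^k = A^(k+1) C] for some [C]; comparing ranks then gives
    [A^k = C' A^(2k+1)] as well, and two such factorisations
    [A^k = A^(2k+1) X = Y A^(2k+1)] yield the Drazin inverse [A^k X = Y A^k].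
    Given this inverse [D], multiplying [A^(k+1) X = A^k B] by [D] turns it into
    [A^k X = A^k D B], whose solutions are [D B + N(A^k)]; and [N(A^k)] meets
    [R(A^k)] trivially because [A^k = D A^(k+1)]. *)

Require Import Defs.
From mathcomp Require Import all_boot all_order all_algebra.
From mathcomp Require Import boolp classical_sets reals.
From mathcomp Require Import complex.
Local Open Scope ring_scope.
Local Open Scope classical_set_scope.
Import GRing.Theory.

(** Both [a ^+ k * x] and [y * a ^+ k] equal [y * a ^+ (k.+1 + k) * x], so [d] can be read in either
    form; each identity follows by picking the suitable one. A [pzRingType] may be trivial, which
    admits matrices of size 0. *)
Lemma pi_regular_drazin (S : pzRingType) (a x y : S) (k : nat) :
  a ^+ k = a ^+ (k.+1 + k) * x -> a ^+ k = y * a ^+ (k.+1 + k) ->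
  exists d, [/\ a ^+ k.+1 * d = a ^+ k, d * a * d = d & a * d = d * a].
Proof.
move=> akx yak; exists (a ^+ k * x).
have dE : a ^+ k * x = y * a ^+ k by rewrite {1}yak -mulrA -akx.
split; first by rewrite mulrA -exprD -akx.
- by rewrite {1}dE -(mulrA y) -exprSr -mulrA (mulrA (a ^+ k.+1)) -exprD -akx dE.
- rewrite {2}dE mulrA -exprS -(mulrA y) -exprSr.
  have {1}-> : a ^+ k.+1 = y * a * a ^+ (k.+1 + k).
    by rewrite exprSr {1}yak -!mulrA -exprSr -exprS.
  by rewrite -mulrA -akx -mulrA -exprS.
Qed.

Lemma mx_drazin (F : fieldType) (n : nat) (a c : 'M[F]_n) (k : nat) :
  a ^+ k = a ^+ k.+1 * c ->
  exists d, [/\ a ^+ k.+1 * d = a ^+ k, d * a * d = d & a * d = d * a].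
Proof.
move=> akc.
(* Substituting the hypothesis into itself [m] times; [m = k.+1] gives the exponent [k.+1 + k]. *)
have akcm m : a ^+ k = a ^+ (m + k) * c ^+ m.
  elim: m => [|m IHm]; first by rewrite mulr1.
  by rewrite {1}IHm exprD {1}akc mulrA -exprD addnS -mulrA -exprS.
have sub : (a ^+ (k.+1 + k) <= a ^+ k)%MS by rewrite exprD submxMl.
have [y yak] : exists y, a ^+ k = y *m a ^+ (k.+1 + k).
  (* A left factor amounts to an inclusion of row spaces. The converse inclusion is [sub], so
     comparing ranks suffices, and the right factorisation [akcm] bounds the rank of [a ^+ k]. *)
  apply/submxP; rewrite -(geq_leqif (mxrank_leqif_sup sub)).
  by rewrite {1}(akcm k.+1) mxrankM_maxl.
exact: pi_regular_drazin (akcm k.+1) yak.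
Qed.

Section TensorMatrix.
Variables (R : realType) (N : nat) (I : 'I_N -> nat).
Implicit Types (A B : tensor R I I) (X Y : tensorv R I).

Definition tensor_mx A : 'M[R[i]]_#|mindex I| :=
  \matrix_(i, j) A (enum_val i, enum_val j).

Definition mx_tensor (M : 'M[R[i]]_#|mindex I|) : tensor R I I :=
  [ffun p => M (enum_rank p.1) (enum_rank p.2)].

Lemma tensor_mxK : cancel tensor_mx mx_tensor.
Proof. by move=> A; apply/ffunP => -[i j]; rewrite ffunE mxE !enum_rankK. Qed.

Lemma mx_tensorK : cancel mx_tensor tensor_mx.
Proof. by move=> M; apply/matrixP => i j; rewrite mxE ffunE !enum_valK. Qed.

Lemma tensor_mxM A B : tensor_mx (A *N B) = tensor_mx A * tensor_mx B.
Proof.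
apply/matrixP => i j; rewrite !mxE ffunE (reindex_onto enum_val enum_rank) /=.
  by apply: eq_big => [l|l _]; rewrite ?enum_valK ?eqxx // !mxE.
by move=> l _; rewrite enum_rankK.
Qed.

Lemma tensor_mxX A n : tensor_mx (A ^N n) = tensor_mx A ^+ n.
Proof.
elim: n => [|n IHn]; last by rewrite exprS -IHn -tensor_mxM.
by apply/matrixP => i j; rewrite !mxE ffunE (inj_eq enum_val_inj).
Qed.

Lemma einsteinvB A X Y : A *v (X - Y) = A *v X - A *v Y.
Proof.
apply/ffunP => i; rewrite !ffunE -sumrB; apply: eq_bigr => k _.
by rewrite !ffunE mulrBr.
Qed.

Lemma tpowSv A n X : (A ^N n.+1) *v X = (A ^N n) *v (A *v X).
Proof. by rewrite !tpowv iterSr. Qed.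

(** Each column of [A] is the image of a basis tensor, hence lies in the range of [B]; chosen
    preimages form the columns of [C]. *)
Lemma trange_factor A B : trange A `<=` trange B -> exists C, A = B *N C.
Proof.
move=> AB.
have /choice[f fP] (j : mindex I) : exists X, B *v X = [ffun i => A (i, j)].
  have [|X _ <-] := AB [ffun i => A (i, j)]; last by exists X.
  exists [ffun l => (l == j)%:R] => //; apply/ffunP => i; rewrite !ffunE.
  rewrite (bigD1 j) //= ffunE eqxx mulr1 big1 ?addr0 // => l /negPf lj.
  by rewrite ffunE lj mulr0.
exists [ffun p => f p.2 p.1]; apply/ffunP => -[i j]; rewrite ffunE.
have /ffunP/(_ i) := fP j; rewrite !ffunE => <-.
by apply: eq_bigr => l _; rewrite ffunE.
Qed.

Lemma trange_ind A : trange (A ^N ind A) = trange (A ^N (ind A).+1).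
Proof. by rewrite /ind; case: ex_minnP => k /asboolP. Qed.

Lemma drazinP A : is_drazin A (drazin A).
Proof.
apply: xgetPex.
have [C AC] : exists C, A ^N ind A = A ^N (ind A).+1 *N C.
  by apply: trange_factor; rewrite trange_ind.
have [|d [d1 d2 d3]] := @mx_drazin _ _ (tensor_mx A) (tensor_mx C) (ind A).
  by rewrite -!tensor_mxX {1}AC tensor_mxM.
exists (mx_tensor d); split; apply: (can_inj tensor_mxK).
- by rewrite tensor_mxM !tensor_mxX mx_tensorK.
- by rewrite !tensor_mxM mx_tensorK.
- by rewrite !tensor_mxM mx_tensorK.
Qed.

Lemma drazin_comm A n X :
  drazin A *v ((A ^N n) *v X) = (A ^N n) *v (drazin A *v X).
Proof.
have [_ _ AD] := drazinP A; rewrite !tpowv.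
by elim: n => //= n <-; rewrite -!einsteinvA AD.
Qed.

Lemma drazin_pow A X :
  (A ^N (ind A).+1) *v (drazin A *v X) = (A ^N ind A) *v X.
Proof. by have [AD _ _] := drazinP A; rewrite -einsteinvA AD. Qed.

(** Applying [drazin A] to the equation lowers the exponent by one; applying [A] goes back. *)
Lemma drazin_eq A X Y :
  (A ^N (ind A).+1) *v X = (A ^N ind A) *v Y <->
  tnull (A ^N ind A) (X - drazin A *v Y).
Proof.
rewrite /tnull mksetE einsteinvB; split=> [AXB|/subr0_eq AXB].
  by rewrite -drazin_comm -AXB drazin_comm drazin_pow subrr.
by rewrite -drazin_pow !tpowv !iterS -!tpowv AXB.
Qed.

Lemma trange_tnull0 A X :
  trange (A ^N ind A) X -> tnull (A ^N ind A) X -> X = 0.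
Proof.
move=> [W _ <-]; rewrite /tnull /= => AAW0.
have einsteinv0 (C : tensor R I I) : C *v 0 = 0.
  by have := einsteinvB C 0 0; rewrite !subrr.
(* On the range of [A ^N ind A], each [drazin A] cancels one [A]. For [m = ind A] the inner term
   vanishes by [AAW0]. *)
have iterD m : (A ^N ind A) *v W =
    iter m (einsteinv (drazin A)) ((A ^N m) *v ((A ^N ind A) *v W)).
  elim: m => [|m IHm]; first by rewrite (tpowv A 0).
  rewrite iterSr tpowSv drazin_comm -(einsteinvA A).
  by rewrite (drazin_comm A (ind A).+1) drazin_pow.
rewrite (iterD (ind A)) AAW0.
by elim: (ind A) => //= m ->; rewrite einsteinv0.
Qed.

End TensorMatrix.

Theorem theorem5p5 (R : realType) (N : nat) (hN : (0 < N)%N)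
    (I : 'I_N -> nat) (hI : forall s : 'I_N, (0 < I s)%N)
    (A : tensor R I I) (k : nat) (hk : ind A = k)
    (B : tensorv R I) (hB : trange (A ^N k) B) :
  [set X : tensorv R I | (A ^N k.+1) *v X = (A ^N k) *v B]
    = [set drazin A *v B + Z | Z in tnull (A ^N k)]
  /\ (trange (A ^N k) (drazin A *v B)
      /\ (A ^N k.+1) *v (drazin A *v B) = (A ^N k) *v B
      /\ forall X : tensorv R I, trange (A ^N k) X ->
           (A ^N k.+1) *v X = (A ^N k) *v B -> X = drazin A *v B).

Proof.
rewrite -{k}hk in hB *; have rDB : trange (A ^N ind A) (drazin A *v B).
  by case: hB => W _ <-; rewrite drazin_comm; exists (drazin A *v W).
have sol X := drazin_eq R N I A X B.
split.
  apply/seteqP; split=> [X /sol nX | _ [Z nZ <-]].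
    by exists (X - drazin A *v B) => //; rewrite addrC subrK.
  by apply/sol; rewrite addrAC subrr add0r.
split=> //; split; first by rewrite drazin_pow.
(* The difference of the two solutions lies in the null space by [sol] and in the range by
   linearity. *)
move=> X [W _ <-] /sol nX; apply: subr0_eq; apply: trange_tnull0 nX.
by case: rDB => V _ <-; exists (W - V) => //; exact: einsteinvB.
Qed.
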